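(* There is an algorithm which, given a real $n\times n$ diagonal matrix $D$ and matrices $U,V\in\mathbb{C}^{n\times k}$ with $k\le n$, computes a unitary matrix $Q$ (as a product of Givens rotations) and the matrix $H=QAQ^H$, where $A=D+UV^H$, such that $H$ is in upper Hessenberg form, using $O(n^2k)$ arithmetic operations (with a constant independent of both $n$ and $k$).
   Context: A matrix $H=(h_{ij})$ is upper Hessenberg if $h_{ij}=0$ for $i>j+1$. Computations are in exact arithmetic; arithmetic operations are operations on complex numbers, including the square roots needed to form Givens rotations. $Q$ may be returned as the sequence of rotations, and $H$ in a data-sparse form, namely by its lower triangular part $\mathrm{tril}(H)$ together with two matrices $\tilde U,\tilde V\in\mathbb{C}^{n\times k}$ such that $H-H^H=\tilde U\tilde V^H-\tilde V\tilde U^H$. $X^H$ denotes the conjugate transpose of $X$. *)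

(* Defs.v *)
From HB Require Import structures.
From mathcomp Require Import all_boot all_order all_algebra.
From mathcomp Require Import complex reals.

Set Implicit Arguments.
Unset Strict Implicit.
Unset Printing Implicit Defensive.

Import Order.TTheory GRing.Theory Num.Theory.
Local Open Scope ring_scope.
Local Open Scope sesquilinear_scope.

(* Model of computation: a random access machine over the complex numbers.   *)
(* A program is a finite syntactic object that mentions neither the sizes n  *)
(* and k nor the complex field, so one and the same program has to work for  *)
(* all inputs. It has natural-number registers, used for indexing and for    *)
(* loop control, and two-dimensional arrays of complex numbers. The only way *)
(* to obtain complex numbers is from 0, 1, the input and the counted         *)
(* arithmetic operations; the only information that flows from complex       *)
(* numbers to the control is the result of the counted tests for zero.       *)
(* Loops are bounded, so that every program terminates.                      *)

Inductive iexp : Type :=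
  | IVar of nat
  | IConst of nat
  | IAdd of iexp & iexp
  | ISub of iexp & iexp (* truncated at 0 *)
  | IMul of iexp & iexp
  | IDiv of iexp & iexp.

Inductive cexp : Type :=
  | CZero
  | COne
  | CGet of nat & iexp & iexp (* entry (i, j) of the array with a given name *)
  | CAdd of cexp & cexp
  | CSub of cexp & cexp
  | CMul of cexp & cexp
  | CDiv of cexp & cexp
  | CConj of cexp
  | CSqrt of cexp.

Inductive cmd : Type :=
  | Skip
  | Seq of cmd & cmd
  | ISet of nat & iexp
  | CSet of nat & iexp & iexp & cexp
  | IfLe of iexp & iexp & cmd & cmd
  | IfZero of cexp & cmd & cmd
  | For of nat & iexp & cmd (* For x e body: x = 0, ..., e - 1 *)
  | Emit of iexp & iexp & cexp & cexp. (* outputs the rotation (i, j, c, s) *)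

(* Number of arithmetic operations in an expression; reading an array entry  *)
(* and the constants 0 and 1 are free.                                       *)
Fixpoint cexp_cost (e : cexp) : nat :=
  match e with
  | CZero | COne | CGet _ _ _ => 0%N
  | CAdd a b | CSub a b | CMul a b | CDiv a b =>
      (cexp_cost a + cexp_cost b).+1%N
  | CConj a | CSqrt a => (cexp_cost a).+1
  end.

Section Semantics.
Variable C : numClosedFieldType.

Record rotation := Rotation {
  rot_i : nat; rot_j : nat; rot_c : C; rot_s : C }.

Record state := State {
  st_ivar : nat -> nat;
  st_mem : nat -> nat -> nat -> C;
  st_rots : seq rotation; (* emitted rotations, the oldest one first *)
  st_cost : nat }.

Fixpoint ieval (iv : nat -> nat) (e : iexp) : nat :=
  match e with
  | IVar x => iv x
  | IConst m => m
  | IAdd a b => (ieval iv a + ieval iv b)%N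
  | ISub a b => (ieval iv a - ieval iv b)%N
  | IMul a b => (ieval iv a * ieval iv b)%N
  | IDiv a b => (ieval iv a %/ ieval iv b)%N
  end.

(* Division is total (x / 0 = 0), which a single test for zero can simulate; *)
(* sqrtC is the principal square root.                                       *)
Fixpoint ceval (iv : nat -> nat) (mem : nat -> nat -> nat -> C) (e : cexp) : C :=
  match e with
  | CZero => 0
  | COne => 1
  | CGet a i j => mem a (ieval iv i) (ieval iv j)
  | CAdd a b => ceval iv mem a + ceval iv mem b
  | CSub a b => ceval iv mem a - ceval iv mem b
  | CMul a b => ceval iv mem a * ceval iv mem b
  | CDiv a b => ceval iv mem a / ceval iv mem b
  | CConj a => (ceval iv mem a)^*
  | CSqrt a => sqrtC (ceval iv mem a)
  end.

Definition set_ivar (x m : nat) (st : state) : state :=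
  State (fun y => if y == x then m else st_ivar st y)
        (st_mem st) (st_rots st) (st_cost st).

Definition set_mem (a i j : nat) (z : C) (st : state) : state :=
  State (st_ivar st)
        (fun a' i' j' =>
           if [&& a' == a, i' == i & j' == j] then z else st_mem st a' i' j')
        (st_rots st) (st_cost st).

Definition emit (g : rotation) (st : state) : state :=
  State (st_ivar st) (st_mem st) (rcons (st_rots st) g) (st_cost st).

Definition pay (m : nat) (st : state) : state :=
  State (st_ivar st) (st_mem st) (st_rots st) (st_cost st + m)%N.

(* A test for zero and the output of a rotation cost one operation each, on  *)
(* top of the evaluation of their arguments. In particular the cost bounds   *)
(* the number of rotations.                                                  *)
Fixpoint exec (p : cmd) (st : state) : state :=
  let iv := st_ivar st in
  let mem := st_mem st in
  match p with
  | Skip => st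
  | Seq p1 p2 => exec p2 (exec p1 st)
  | ISet x e => set_ivar x (ieval iv e) st
  | CSet a i j e =>
      pay (cexp_cost e)
        (set_mem a (ieval iv i) (ieval iv j) (ceval iv mem e) st)
  | IfLe e1 e2 p1 p2 =>
      if (ieval iv e1 <= ieval iv e2)%N then exec p1 st else exec p2 st
  | IfZero e p1 p2 =>
      let st' := pay (cexp_cost e).+1%N st in
      if ceval iv mem e == 0 then exec p1 st' else exec p2 st'
  | For x e body =>
      foldl (fun st' m => exec body (set_ivar x m st')) st
            (iota 0 (ieval iv e))
  | Emit i j c s =>
      pay (cexp_cost c + cexp_cost s).+1%N
        (emit (Rotation (ieval iv i) (ieval iv j)
                        (ceval iv mem c) (ceval iv mem s)) st)
  end.

Definition load m n (M : 'M[C]_(m, n)) (i j : nat) : C :=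
  match insub i, insub j with
  | Some i', Some j' => M i' j'
  | _, _ => 0
  end.

Definition array (st : state) (a m n : nat) : 'M[C]_(m, n) :=
  \matrix_(i < m, j < n) st_mem st a i j.

(* Input convention: n and k in the index registers 0 and 1, the matrices D, *)
(* U, V in the arrays 0, 1, 2; everything else is 0.                         *)
Definition init n k (D : 'M[C]_n) (U V : 'M[C]_(n, k)) : state :=
  State (fun x => match x with 0%N => n | 1%N => k | _ => 0%N end)
        (fun a => match a with
                  | 0%N => load D
                  | 1%N => load U
                  | 2%N => load V
                  | _ => fun _ _ => 0
                  end)
        [::] 0%N.

(* Output convention: tril(H) and its generators in the arrays 3, 4, 5.      *)
Definition out_tril (st : state) (n : nat) : 'M[C]_n := array st 3 n n.
Definition out_U (st : state) (n k : nat) : 'M[C]_(n, k) := array st 4 n k.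
Definition out_V (st : state) (n k : nat) : 'M[C]_(n, k) := array st 5 n k.

(* Acts as [[c, s], [- s^*, c]], with c real, on the coordinates i and j.    *)
Definition givens_ok (n : nat) (g : rotation) : bool :=
  [&& (rot_i g < n)%N, (rot_j g < n)%N, rot_i g != rot_j g,
      rot_c g \is Num.real & `|rot_c g| ^+ 2 + `|rot_s g| ^+ 2 == 1].

Definition givens (n : nat) (g : rotation) : 'M[C]_n :=
  \matrix_(a < n, b < n)
    if (a == rot_i g :> nat) && (b == rot_i g :> nat) then rot_c g
    else if (a == rot_i g :> nat) && (b == rot_j g :> nat) then rot_s g
    else if (a == rot_j g :> nat) && (b == rot_i g :> nat) then - (rot_s g)^*
    else if (a == rot_j g :> nat) && (b == rot_j g :> nat) then rot_c g
    else (a == b)%:R.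

(* For gs = [:: G_1; ...; G_m] this is G_m ... G_1.                          *)
Definition givens_prod (n : nat) (gs : seq rotation) : 'M[C]_n :=
  foldl (fun Q g => givens n g *m Q) 1%:M gs.

Definition upper_hessenberg n (H : 'M[C]_n) : Prop :=
  forall i j : 'I_n, (j.+1 < i)%N -> H i j = 0.

Definition tril n (H : 'M[C]_n) : 'M[C]_n :=
  \matrix_(i < n, j < n) if (j <= i)%N then H i j else 0.

End Semantics.

(* Main.v *)
Require Import Defs.
From HB Require Import structures.
From mathcomp Require Import all_boot all_order all_algebra.
From mathcomp Require Import complex reals.
From mathcomp Require Import zify ring.

Set Implicit Arguments.
Unset Strict Implicit.
Unset Printing Implicit Defensive.

Import Order.TTheory GRing.Theory Num.Theory.
Local Open Scope ring_scope.
Local Open Scope sesquilinear_scope.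

(** All rotations act in planes (q - 1, q). The working matrix M is always of
    lower bandwidth at most k + 1 and M - M^H has known generators of rank k,
    so only a window of O(k) entries of its lower triangle changes under a
    rotation, the one missing entry above the diagonal being recovered from
    the generators in O(k) operations. Hence a rotation, including the update
    of U and V, costs O(k), and it remains to use O(n^2) of them.

    First, S = Q D Q^H becomes banded and Q U upper triangular: for p = n - 1
    down to 0 the rows and columns from p on are treated; when row p is added,
    the matrix [U | S] on the rows from p on has one nonzero diagonal too many,
    and the rotations q = p + 1, ..., n - 1, removing one entry of it each,
    suffice, because the bulges that they create lie on that same diagonal.

    Then A = S + (Q U)(Q V)^H has lower bandwidth k, and it is brought to
    Hessenberg form column by column, every entry from the outermost inwards;
    each bulge is chased off the matrix in steps of k rows, which makes about
    n (k - 1) (n / k + 1) = O(n^2) rotations. *)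

(** * Givens rotations *)

Section Rotations.
Variable C : numClosedFieldType.

Lemma trmxCK m n (M : 'M[C]_(m, n)) : M ^t* ^t* = M.
Proof. by apply/matrixP=> i j; rewrite !mxE conjCK. Qed.

Lemma trmxC_mul m n p (A : 'M[C]_(m, n)) (B : 'M[C]_(n, p)) :
  (A *m B) ^t* = B ^t* *m A ^t*.
Proof. by rewrite trmx_mul map_mxM. Qed.

Lemma trmxC_add m n (A B : 'M[C]_(m, n)) : (A + B) ^t* = A ^t* + B ^t*.
Proof. by rewrite raddfD map_mxD. Qed.

Section Plane.
Variables (n : nat) (p q : 'I_n) (c s : C).
Hypotheses (neq_pq : p != q) (c_real : c \is Num.real)
  (cs1 : `|c| ^+ 2 + `|s| ^+ 2 = 1).
Let G := givens n (Rotation p q c s).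

Lemma givens_mulE m (M : 'M[C]_(n, m)) i j :
  (G *m M) i j = if i == p then c * M p j + s * M q j
                 else if i == q then c * M q j - s^* * M p j else M i j.
Proof.
rewrite mxE; have [-> | ip] := eqVneq i p.
  rewrite (bigD1 p) //= (bigD1 q) 1?eq_sym //= !mxE /= !eqxx /=.
  rewrite !(inj_eq val_inj) eq_sym (negPf neq_pq) /= big1 ?addr0 //.
  move=> b /andP[bp bq]; rewrite !mxE /= !(inj_eq val_inj) eqxx.
  by rewrite (negPf bp) (negPf bq) (negPf neq_pq) eq_sym (negPf bp) mul0r.
have [-> | iq] := eqVneq i q.
  rewrite (bigD1 q) //= (bigD1 p) //= !mxE /= !(inj_eq val_inj) !eqxx /=.
  rewrite eq_sym (negPf neq_pq) /= big1 ?addr0 ?mulNr // => b /andP[bq bp].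
  rewrite !mxE /= !(inj_eq val_inj) eqxx (negPf bp) (negPf bq) eq_sym.
  by rewrite (negPf neq_pq) eq_sym (negPf bq) mul0r.
rewrite (bigD1 i) //= !mxE !(inj_eq val_inj) (negPf ip) (negPf iq) eqxx.
rewrite mul1r big1 ?addr0 // => b bi.
by rewrite !mxE !(inj_eq val_inj) (negPf ip) (negPf iq) /= eq_sym (negPf bi) mul0r.
Qed.

Lemma mul_givens_trmxCE m (M : 'M[C]_(m, n)) i j :
  (M *m G ^t*) i j = if j == p then c * M i p + s^* * M i q
                     else if j == q then c * M i q - s * M i p else M i j.
Proof.
have -> : M *m G ^t* = (G *m M ^t*) ^t* by rewrite trmxC_mul trmxCK.
rewrite mxE [_^T _ _]mxE givens_mulE !mxE.
have /CrealP cc := c_real.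
by case: ifP => _; [|case: ifP => _];
  rewrite ?(rmorphD, rmorphN, rmorphM) /= ?(conjCK, cc).
Qed.

Lemma givens_unitary : G \is unitarymx.
Proof.
apply/unitarymxP/matrixP=> i j; rewrite mul_givens_trmxCE !mxE /=.
have /CrealP cc := c_real; move: cs1; rewrite !normCK cc => cs.
have qp : (q == p) = false by rewrite eq_sym (negPf neq_pq).
rewrite !(inj_eq val_inj) !eqxx !qp ?(negPf neq_pq) /=.
have [ip | ip] := eqVneq i p; have [iq | iq] := eqVneq i q;
  have [jp | jp] := eqVneq j p; have [jq | jq] := eqVneq j q;
  rewrite ?ip ?iq ?jp ?jq ?eqxx ?qp ?(negPf neq_pq) /=.
all: try by rewrite -?cs; ring.
all: by rewrite ?(negPf ip) ?(negPf iq) !mulr0 ?subr0 ?addr0.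
Qed.

End Plane.

(** The factor [N / x^*] is a phase, so [c] stays real while [s] carries the arguments of both
    entries. [N] is [|x|], written with counted operations only. For [x = 0] the rotation is a swap,
    which works for every [y] and avoids a division by 0. *)
Definition rot_params (x y : C) : C * C :=
  if x == 0 then (0, 1) else
  let N := sqrtC (x * x^*) in let rho := sqrtC (x * x^* + y * y^*) in
  (N / rho, N * y^* / (x^* * rho)).

Lemma rot_paramsP x y (c := (rot_params x y).1) (s := (rot_params x y).2) :
  [/\ c \is Num.real, `|c| ^+ 2 + `|s| ^+ 2 = 1 & c * y - s^* * x = 0].
Proof.
rewrite /c /s /rot_params; case: eqVneq => [-> | x0] /=.
  by split; rewrite ?rpred0 // ?normr0 ?normr1 ?expr0n ?expr1n ?add0r // mul0r mulr0 subrr.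
rewrite -[x * _]normCK -[y * _]normCK.
have Nx : sqrtC (`|x| ^+ 2) = `|x| by rewrite sqrCK ?normr_ge0.
rewrite Nx; set rho := sqrtC _.
have r2 : rho ^+ 2 = `|x| ^+ 2 + `|y| ^+ 2 by rewrite sqrtCK.
have rr : 0 <= rho by rewrite sqrtC_ge0 addr_ge0 // exprn_ge0.
have rc : rho^* = rho by apply/CrealP; rewrite ger0_real.
have nx : `|x| != 0 by rewrite normr_eq0.
have rn : rho != 0.
  rewrite -sqrf_eq0 r2 gt_eqF // ltr_wpDr ?exprn_ge0 ?exprn_gt0 ?normr_gt0 //.
have xc : x^* != 0 by rewrite conjC_eq0.
split.
- by rewrite ger0_real ?divr_ge0.
- rewrite !(normrM, normfV) !normr_id !norm_conjC (ger0_norm rr) !(exprMn, exprVn).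
  rewrite r2; move: rn; rewrite -sqrf_eq0 r2 => rn.
  by field; rewrite ?nx ?rn.
- rewrite !(rmorphM, fmorphV) /= !conjCK rc.
  have -> : (`|x|)^* = `|x| by apply/CrealP; rewrite ger0_real.
  by field; rewrite x0 rn.
Qed.
End Rotations.

(** * The program

    Arrays: 0 holds the lower triangle of the working matrix (its strict upper
    part is garbage), 1 and 2 hold Q U and Q V, 6 the pair to be rotated onto
    its first entry, 7 the pair (c, s), 8 a scratch cell.
    Registers: 2 holds 0 while the working matrix is Hermitian and k when its
    skew part is U V^H - V U^H, 3 the lower row q of the rotation, 8 the column
    of the bulge, 9 the first active row p; 4 to 7 are loop variables. *)

Definition idx0 := IConst 0.
Definition idx1 := IConst 1.
Definition rowq := IVar 3.
Definition rowp := ISub rowq idx1.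
Definition cosE := CGet 7 idx0 idx0.
Definition sinE := CGet 7 idx0 idx1.

(** Both new entries depend on both old ones, so the first waits in the scratch cell. [s] is an
    expression because multiplying by [G^H] on the right is the same update of columns with the sine
    conjugated. *)
Definition rotate_cells a ip jp iq jq s :=
  Seq (CSet 8 idx0 idx0 (CAdd (CMul cosE (CGet a ip jp)) (CMul s (CGet a iq jq))))
 (Seq (CSet a iq jq (CSub (CMul cosE (CGet a iq jq)) (CMul (CConj s) (CGet a ip jp))))
      (CSet a ip jp (CGet 8 idx0 idx0))).

Definition rotate_loop N g1 g2 a ip jp iq jq s :=
  For 4 N (IfLe g1 g2 (rotate_cells a ip jp iq jq s) Skip).

Lemma ieval_ext iv iv' e : iv =1 iv' -> ieval iv e = ieval iv' e.
Proof. by move=> E; elim: e => //= *; congruence. Qed.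

(** * Semantics of the rotation procedure *)

Section Loops.
Variable C : numClosedFieldType.
Implicit Types (st : state C) (I : nat -> state C -> Prop).

Lemma exec_Seq p1 p2 st : exec (Seq p1 p2) st = exec p2 (exec p1 st).
Proof. by []. Qed.

(** Invariant rule. The bound is evaluated once, on entry, so [N] does not follow later changes of
    the registers. *)
Lemma exec_For I st x e body (N := ieval (st_ivar st) e) :
    I 0%N st ->
    (forall m st', (m < N)%N -> I m st' -> I m.+1 (exec body (set_ivar x m st'))) ->
  I N (exec (For x e body) st).
Proof.
move=> I0 IS /=; rewrite -/N.
have: forall m, (m <= N)%N ->
    I m (foldl (fun st' m => exec body (set_ivar x m st')) st (iota 0 m)).
  elim=> // m IHm ltmN; rewrite -addn1 iotaD foldl_cat /= add0n addn1.
  by apply: IS => //; apply: IHm; apply: ltnW.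
exact.
Qed.

Section RotateLoop.
Variables (a : nat) (s : cexp) (st : state C) (sv : C).
Hypotheses (a_lt3 : (a < 3)%N) (s_cost : (cexp_cost s <= 1)%N)
  (s_eval : forall iv (mem : nat -> nat -> nat -> C),
     mem 7%N 0%N 1%N = st_mem st 7 0%N 1%N -> ceval iv mem s = sv).
Let cv := st_mem st 7 0%N 0%N.

Lemma exec_rotate_cells ip jp iq jq st' (iv := st_ivar st')
    (p1 := ieval iv ip) (p2 := ieval iv jp) (q1 := ieval iv iq) (q2 := ieval iv jq)
    (st'' := exec (rotate_cells a ip jp iq jq s) st') :
    (forall i j, st_mem st' 7 i j = st_mem st 7 i j) ->
  [/\ st_ivar st'' = st_ivar st', st_rots st'' = st_rots st',
      (st_cost st'' <= st_cost st' + 9)%N &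
      forall a' i j : nat, a' != 8%N -> st_mem st'' a' i j =
        if [&& a' == a, i == p1 & j == p2] then
          cv * st_mem st' a p1 p2 + sv * st_mem st' a q1 q2
        else if [&& a' == a, i == q1 & j == q2] then
          cv * st_mem st' a q1 q2 - sv^* * st_mem st' a p1 p2
        else st_mem st' a' i j].
Proof.
move=> m7; rewrite /st'' /=; split=> //; first lia.
move=> a' i j a8; rewrite -/iv -/p1 -/p2 -/q1 -/q2.

have na8 : (8 != a)%N by lia.
by rewrite (negPf a8) [a == _]eq_sym /= (negPf na8) !s_eval ?m7 //=.
Qed.

Variables (N g1 g2 ip jp iq jq : iexp).
Let ev e m := ieval (fun x => if x == 4%N then m else st_ivar st x) e.
Let X1 m := (ev ip m, ev jp m).
Let X2 m := (ev iq m, ev jq m).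
Let act m := (m < ieval (st_ivar st) N)%N && (ev g1 m <= ev g2 m)%N.
Hypothesis disj : forall m m', act m -> act m' ->
  X1 m != X2 m' /\ (m != m' -> X1 m != X1 m' /\ X2 m != X2 m').
Let at_ st' (z : nat * nat) := st_mem st' a z.1 z.2.

(** By [disj] the pairs of cells of distinct active iterations do not meet, so each iteration reads
    values of the initial state and the loop acts as one simultaneous rotation of all active
    pairs. *)
Lemma exec_rotate_loop (st' := exec (rotate_loop N g1 g2 a ip jp iq jq s) st) :
  [/\ forall x : nat, x != 4%N -> st_ivar st' x = st_ivar st x,
      st_rots st' = st_rots st,
      (st_cost st' <= st_cost st + 9 * ieval (st_ivar st) N)%N,
      forall a' i j : nat, a' != 8%N -> a' != a -> st_mem st' a' i j = st_mem st a' i j &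
      (forall z, (forall m, act m -> z != X1 m /\ z != X2 m) -> at_ st' z = at_ st z)
      /\ (forall m, act m ->
            at_ st' (X1 m) = cv * at_ st (X1 m) + sv * at_ st (X2 m) /\
            at_ st' (X2 m) = cv * at_ st (X2 m) - sv^* * at_ st (X1 m))].
Proof.
pose I m st' := [/\ forall x : nat, x != 4%N -> st_ivar st' x = st_ivar st x,
      st_rots st' = st_rots st,
      (st_cost st' <= st_cost st + 9 * m)%N,
      forall a' i j : nat, a' != 8%N -> a' != a -> st_mem st' a' i j = st_mem st a' i j &
      (forall z, (forall m', (m' < m)%N -> act m' -> z != X1 m' /\ z != X2 m') ->
         at_ st' z = at_ st z)
      /\ (forall m', (m' < m)%N -> act m' ->
            at_ st' (X1 m') = cv * at_ st (X1 m') + sv * at_ st (X2 m') /\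
            at_ st' (X2 m') = cv * at_ st (X2 m') - sv^* * at_ st (X1 m'))].
suff : I (ieval (st_ivar st) N) st'.
  case=> h1 h2 h3 h4 [h5 h6]; split=> //; split=> [z hz|m am].
    by apply: h5 => m _; apply: hz.
  by apply: h6 => //; case/andP: am.
apply: exec_For => [|m st1 ltm [h1 h2 h3 h4 [h5 h6]]].
  by split=> //; rewrite muln0 addn0.
set st2 := set_ivar 4 m st1.
have ivE : st_ivar st2 =1 (fun x => if x == 4%N then m else st_ivar st x).
  by move=> x /=; case: eqP => // /eqP; apply: h1.
have evE e : ieval (st_ivar st2) e = ev e m by apply: ieval_ext.
have -> : exec (IfLe g1 g2 (rotate_cells a ip jp iq jq s) Skip) st2 =
  if (ev g1 m <= ev g2 m)%N then exec (rotate_cells a ip jp iq jq s) st2 else st2.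
  by rewrite -!evE.
case: ifP => g; last first.
  have nact : act m = false by rewrite /act g andbF.
  split=> //.
  - by move=> x x4; rewrite ivE (negPf x4).
  - by apply: leq_trans h3 _; rewrite leq_add2l leq_mul2l leqnSn orbT.
  - split=> [z hz|m' ltm' am']; first by apply: h5 => m' ltm'; apply: hz; lia.
    apply: h6 => //; rewrite ltn_neqAle -ltnS ltm' andbT.
    by apply: contraTneq am' => ->; rewrite nact.
have am : act m by rewrite /act ltm g.
have m7 i j : st_mem st2 7 i j = st_mem st 7 i j by apply: h4 => //; lia.
have [] := @exec_rotate_cells ip jp iq jq st2 m7; rewrite !evE.
set st3 := exec _ st2 => e1 e2 e3 e4.
have cell2 z : at_ st2 z = at_ st1 z by [].
have cell z : at_ st3 z =
    if z == X1 m then cv * at_ st2 (X1 m) + sv * at_ st2 (X2 m)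
    else if z == X2 m then cv * at_ st2 (X2 m) - sv^* * at_ st2 (X1 m)
    else at_ st1 z.
  by case: z => i j; rewrite /at_ e4 ?eqxx /=; last lia.
(* The current pair is disjoint from all pairs treated before, hence still has its initial
   values. *)
have old z : z = X1 m \/ z = X2 m -> at_ st2 z = at_ st z.
  move=> hz; rewrite cell2; apply: h5 => m' ltm' am'.
  have [d1 /(_ _)[|d2 d3]] := disj am am'; first by lia.
  have [d4 _] := disj am' am.
  by case: hz => ->; rewrite ?d1 ?d2 ?d3; split=> //; rewrite eq_sym.
rewrite !old in cell; try by [left | right].
split.
- by move=> x x4; rewrite e1 ivE (negPf x4).
- by rewrite e2.
- by move: e3 h3; rewrite /=; lia.
- by move=> a' i j a8 aa; rewrite e4 // (negPf aa) /= h4.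
- split=> [z hz|m' ltm' am'].
    have [n1 n2] := hz m (ltnSn m) am.
    by rewrite cell (negPf n1) (negPf n2) h5 // => m' ltm'; apply: hz; lia.
  have [->|nm] := eqVneq m' m.
    rewrite !cell !eqxx; have [d1 _] := disj am am.
    by rewrite eq_sym (negPf d1).
  have [d1 /(_ nm)[d2 d3]] := disj am' am.
  have [d4 _] := disj am am'; rewrite eq_sym in d4.
  have lt' : (m' < m)%N by lia.
  by have [<- <-] := h6 m' lt' am'; rewrite !cell (negPf d1) (negPf d2) (negPf d3) (negPf d4).
Qed.
End RotateLoop.
End Loops.

(** * Rotation parameters, the entry above the diagonal, and the windowed updates *)

Definition loopv := IVar 4.
Definition pivx := CGet 6 idx0 idx0.
Definition pivy := CGet 6 idx0 idx1.
Definition sqx := CMul pivx (CConj pivx).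
Definition sqy := CMul pivy (CConj pivy).
Definition set_params :=
  IfZero pivx (Seq (CSet 7 idx0 idx0 CZero) (CSet 7 idx0 idx1 COne))
    (Seq (CSet 7 idx0 idx0 (CDiv (CSqrt sqx) (CSqrt (CAdd sqx sqy))))
         (CSet 7 idx0 idx1 (CDiv (CMul (CSqrt sqx) (CConj pivy))
                             (CMul (CConj pivx) (CSqrt (CAdd sqx sqy)))))).

Definition fill_conj := CSet 0 rowp rowq (CConj (CGet 0 rowq rowp)).
Definition fill_step :=
  CSet 0 rowp rowq (CAdd (CGet 0 rowp rowq)
    (CSub (CMul (CGet 1 rowp loopv) (CConj (CGet 2 rowq loopv)))
          (CMul (CGet 2 rowp loopv) (CConj (CGet 1 rowq loopv))))).
Definition fill_upper := Seq fill_conj (For 4 (IVar 2) fill_step).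

Definition rotate_gen a := rotate_loop (IVar 1) idx0 idx0 a rowp loopv rowq loopv sinE.

(* Row and column offsets 0, ..., k + 2 cover the band of width k + 1 of both rows. *)
Definition window := IAdd (IVar 1) (IConst 3).
Definition rotate_rows :=
  rotate_loop window loopv rowq 0 rowp (ISub rowq loopv) rowq (ISub rowq loopv) sinE.
(** The row is [i = q - 1 + m] for the loop value [m], so the guard [q + m <= n] expresses
    [i < n]. *)
Definition rotate_cols :=
  rotate_loop window (IAdd rowq loopv) (IVar 0) 0
    (IAdd rowp loopv) rowp (IAdd rowp loopv) rowq (CConj sinE).

(** The order matters: the missing entry is computed from the generators before they are rotated,
    and the column update reads this entry after the row update. *)
Definition rotate :=
  Seq set_params (Seq (Emit rowp rowq cosE sinE) (Seq fill_upper
  (Seq (rotate_gen 1) (Seq (rotate_gen 2) (Seq rotate_rows rotate_cols))))).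

Section Rotate.
Variable C : numClosedFieldType.
Implicit Types st : state C.

Definition frame (mods : seq nat) st st' :=
  [/\ forall x : nat, x != 4%N -> st_ivar st' x = st_ivar st x &
      forall a i j : nat, a \notin mods -> st_mem st' a i j = st_mem st a i j].

Lemma exec_set_params st (st' := exec set_params st)
    (cs := rot_params (st_mem st 6 0 0) (st_mem st 6 0 1)) :
  [/\ frame [:: 7%N] st st', st_rots st' = st_rots st,
      (st_cost st' <= st_cost st + 25)%N, st_mem st' 7 0 0 = cs.1 &
      st_mem st' 7 0 1 = cs.2].
Proof.
rewrite /st' /cs /rot_params /=; case: ifP => _ /=; split=> //; try lia.
all: by split=> //= a i j; rewrite inE => /negPf ->.
Qed.

Lemma exec_fill_upper st (st' := exec fill_upper st)
    (q := st_ivar st 3) (p := (q - 1)%N) : (0 < q)%N ->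
  [/\ forall x : nat, x != 4%N -> st_ivar st' x = st_ivar st x, st_rots st' = st_rots st,
      (st_cost st' <= st_cost st + 1 + 6 * st_ivar st 2)%N,
      forall a i j : nat, ~~ [&& a == 0, i == p & j == q]%N ->
        st_mem st' a i j = st_mem st a i j &
      st_mem st' 0 p q = (st_mem st 0 q p)^* + \sum_(0 <= m < st_ivar st 2)
        (st_mem st 1 p m * (st_mem st 2 q m)^* - st_mem st 2 p m * (st_mem st 1 q m)^*)].
Proof.
move=> q0; pose I m st' := [/\
      forall x : nat, x != 4%N -> st_ivar st' x = st_ivar st x, st_rots st' = st_rots st,
      (st_cost st' <= st_cost st + 1 + 6 * m)%N,
      forall a i j : nat, ~~ [&& a == 0, i == p & j == q]%N ->
        st_mem st' a i j = st_mem st a i j &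
      st_mem st' 0 p q = (st_mem st 0 q p)^* + \sum_(0 <= m < m)
        (st_mem st 1 p m * (st_mem st 2 q m)^* - st_mem st 2 p m * (st_mem st 1 q m)^*)].
suff: I (st_ivar st 2) st' by [].
pose st1 := exec fill_conj st.
change (I (ieval (st_ivar st1) (IVar 2)) (exec (For 4 (IVar 2) fill_step) st1)).
apply: exec_For => [|m st2 ltm [h1 h2 h3 h4 h5]].
  split=> //=; first by lia.
    by move=> a i j; rewrite -/q -/p => /negPf ->.
  by rewrite -/q !eqxx /= big_geq ?addr0.
split=> //=.
- by move=> x x4; rewrite (negPf x4) h1.
- by lia.
- by move=> a i j; rewrite h1 // -/q -/p => h; rewrite (negPf h) h4.
- rewrite h1 // -/q -/p !eqxx /= h5 big_nat_recr //= addrA.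
  by rewrite !h4 //= !addrA.
Qed.

Lemma exec_rotate_gen st a (st' := exec (rotate_gen a) st)
    (q := st_ivar st 3) (p := (q - 1)%N) (c := st_mem st 7 0 0) (s := st_mem st 7 0 1) :
    (0 < q)%N -> (a < 3)%N ->
  [/\ frame [:: a; 8%N] st st', st_rots st' = st_rots st,
      (st_cost st' <= st_cost st + 9 * st_ivar st 1)%N &
      forall i m, (m < st_ivar st 1)%N -> st_mem st' a i m =
        if i == p then c * st_mem st a p m + s * st_mem st a q m
        else if i == q then c * st_mem st a q m - s^* * st_mem st a p m
        else st_mem st a i m].
Proof.
move=> q0 a3.
have := @exec_rotate_loop _ a sinE st s a3 isT (fun _ _ => id) (IVar 1) idx0 idx0
  rowp loopv rowq loopv.
rewrite /= -/q -/p => /(_ _)[m m' _ _|h1 h2 h3 h4 [h5 h6]].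
  by rewrite /eq_op /=; lia.
split=> //.
  by split=> // a' i j; rewrite !inE negb_or => /andP[? ?]; apply: h4.
move=> i m ltm; have [h7 h8] := h6 m (introT andP (conj ltm isT)).
case: eqP => [-> //|ip]; case: eqP => [-> //|iq].
by apply: (h5 (i, m)) => m' _; rewrite /eq_op /=; lia.
Qed.

Lemma exec_rotate_rows st (st' := exec rotate_rows st) (k := st_ivar st 1)
    (q := st_ivar st 3) (p := (q - 1)%N) (c := st_mem st 7 0 0) (s := st_mem st 7 0 1) :
    (0 < q)%N ->
  [/\ frame [:: 0; 8]%N st st', st_rots st' = st_rots st,
      (st_cost st' <= st_cost st + 9 * (k + 3))%N &
      forall i j, st_mem st' 0 i j =
        if (j <= q < j + (k + 3))%N then
          if i == p then c * st_mem st 0 p j + s * st_mem st 0 q j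
          else if i == q then c * st_mem st 0 q j - s^* * st_mem st 0 p j
          else st_mem st 0 i j
        else st_mem st 0 i j].
Proof.
move=> q0.
have := @exec_rotate_loop _ 0 sinE st s isT isT (fun _ _ => id) window loopv rowq
  rowp (ISub rowq loopv) rowq (ISub rowq loopv).
rewrite /= -/q -/p -/k => /(_ _)[m m' /andP[_ ?] /andP[_ ?]|h1 h2 h3 h4 [h5 h6]].
  by rewrite /eq_op /=; lia.
split=> //.
  by split=> // a' i j; rewrite !inE negb_or => /andP[? ?]; apply: h4.
move=> i j; case: ifP => [/andP[jq qj]|njq].
  have [|] := h6 (q - j)%N; first by lia.
  rewrite subKn // => h7 h8.
  case: eqP => [-> //|ip]; case: eqP => [-> //|iq].
  by apply: (h5 (i, j)) => m' _; rewrite /eq_op /=; lia.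
by apply: (h5 (i, j)) => m' /andP[? ?]; rewrite /eq_op /=; lia.
Qed.

Lemma exec_rotate_cols st (st' := exec rotate_cols st) (n := st_ivar st 0) (k := st_ivar st 1)
    (q := st_ivar st 3) (p := (q - 1)%N) (c := st_mem st 7 0 0) (s := st_mem st 7 0 1) :
    (0 < q)%N ->
  [/\ frame [:: 0; 8]%N st st', st_rots st' = st_rots st,
      (st_cost st' <= st_cost st + 9 * (k + 3))%N &
      forall i j, st_mem st' 0 i j =
        if (p <= i < p + (k + 3))%N && (i < n)%N then
          if j == p then c * st_mem st 0 i p + s^* * st_mem st 0 i q
          else if j == q then c * st_mem st 0 i q - s * st_mem st 0 i p
          else st_mem st 0 i j
        else st_mem st 0 i j].
Proof.
move=> q0.
have cs iv (mem : nat -> nat -> nat -> C) :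
  mem 7%N 0%N 1%N = st_mem st 7 0 1 -> ceval iv mem (CConj sinE) = s^*.
  by move=> /= ->.
have := @exec_rotate_loop _ 0 (CConj sinE) st _ isT isT cs window (IAdd rowq loopv) (IVar 0)
  (IAdd rowp loopv) rowp (IAdd rowp loopv) rowq.
rewrite /= -/q -/p -/k -/n => /(_ _)[m m' /andP[_ ?] /andP[_ ?]|h1 h2 h3 h4 [h5 h6]].
  by rewrite /eq_op /=; lia.
split=> //.
  by split=> // a' i j; rewrite !inE negb_or => /andP[? ?]; apply: h4.
move=> i j; case: ifP => [/andP[/andP[pi ip] lin]|nij].
  have [|] := h6 (i - p)%N; first by lia.
  rewrite subnKC // conjCK => h7 h8.
  case: eqP => [-> //|jp]; case: eqP => [-> //|jq].
  by apply: (h5 (i, j)) => m' _; rewrite /eq_op /=; lia.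
by apply: (h5 (i, j)) => m' /andP[? ?]; rewrite /eq_op /=; lia.
Qed.
End Rotate.

(** * The invariant between memory and the conjugated matrix *)

Section Representation.
Variables (C : numClosedFieldType) (n k : nat) (U0 V0 : 'M[C]_(n, k)).
Implicit Types (st : state C) (M : 'M[C]_n).

Definition accQ st := givens_prod n (st_rots st).
Definition curM M st := accQ st *m M *m (accQ st) ^t*.
Definition curU st := accQ st *m U0.
Definition curV st := accQ st *m V0.

(** [M] is the matrix before any rotation: first [D], later [A], with the same accumulated product
    of rotations. Only the lower triangle is constrained. *)
Record represents M kk st : Prop := Represents {
  repr_n : st_ivar st 0 = n;
  repr_k : st_ivar st 1 = k;
  repr_kk : st_ivar st 2 = kk;
  repr_ok : all (givens_ok n) (st_rots st);
  repr_U : forall (i : 'I_n) (m : 'I_k), st_mem st 1 i m = curU st i m;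
  repr_V : forall (i : 'I_n) (m : 'I_k), st_mem st 2 i m = curV st i m;
  repr_M : forall i j : 'I_n, (j <= i)%N -> st_mem st 0 i j = curM M st i j }.

Definition skew_part M kk :=
  (kk = 0%N /\ M - M ^t* = 0) \/
  (kk = k /\ M - M ^t* = U0 *m V0 ^t* - V0 *m U0 ^t*).

Lemma givens_prod_rcons (gs : seq (rotation C)) g : 
  givens_prod n (rcons gs g) = givens n g *m givens_prod n gs.
Proof. by rewrite /givens_prod foldl_rcons. Qed.

(** Write [M] as [M^H + (M - M^H)] and conjugate: the skew part keeps its form, with generators
    multiplied by the accumulated rotations, which are the stored arrays 1 and 2. *)
Lemma upper_entry M kk st (p q : 'I_n) : skew_part M kk -> represents M kk st ->
  curM M st p q = (curM M st q p)^* + \sum_(0 <= m < kk)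
    (st_mem st 1 p m * (st_mem st 2 q m)^* - st_mem st 2 p m * (st_mem st 1 q m)^*).
Proof.
move=> sk rp; have [_ _ _ _ rU rV _] := rp.
suff -> : \sum_(0 <= m < kk) (st_mem st 1 p m * (st_mem st 2 q m)^* -
    st_mem st 2 p m * (st_mem st 1 q m)^*) =
  (accQ st *m (M - M ^t*) *m (accQ st) ^t*) p q.
  rewrite mulmxBr mulmxBl -/(curM M st).
  have -> : accQ st *m M ^t* *m (accQ st) ^t* = (curM M st) ^t*.
    by rewrite /curM !trmxC_mul trmxCK mulmxA.
  by move: (curM M st) => A; rewrite !mxE addrCA subrr addr0.
case: sk => [[-> ->]|[-> ->]]; first by rewrite big_geq // mulmx0 mul0mx mxE.
have -> : accQ st *m (U0 *m V0 ^t* - V0 *m U0 ^t*) *m (accQ st) ^t* =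
    curU st *m (curV st) ^t* - curV st *m (curU st) ^t*.
  by rewrite /curU /curV !trmxC_mul mulmxBr mulmxBl !mulmxA.
rewrite big_mkord; under eq_bigr do rewrite !rU !rV.
move: (curU st) (curV st) => U V; rewrite !mxE -sumrB.
by apply: eq_bigr => m _; rewrite !mxE.
Qed.

(** Updating only the window is enough: outside it, by [band], both entries of every pair to be
    combined vanish, and so do their rotated values. *)
Lemma exec_rotate M kk st (p q : 'I_n) (st' := exec rotate st)
    (cs := rot_params (st_mem st 6 0 0) (st_mem st 6 0 1)) :
    skew_part M kk -> represents M kk st -> (0 < k)%N -> q = p.+1 :> nat ->
    st_ivar st 3 = q ->
    (forall i j : 'I_n, (j + k + 1 < i)%N -> curM M st i j = 0) ->
  [/\ represents M kk st',
      st_rots st' = rcons (st_rots st) (Rotation p q cs.1 cs.2),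
      forall x : nat, x != 4%N -> st_ivar st' x = st_ivar st x &
      (st_cost st' <= st_cost st + 200 * k)%N].
Proof.
move=> sk rp k0 qp sq band; have [rn rk rkk rok rU rV rM] := rp.
have kkk : (kk <= k)%N by case: sk => [[-> _]|[-> _]].
have q0 : (0 < q)%N by rewrite qp.
have pE : (q - 1)%N = p by lia.
have neq_pq : p != q by apply/eqP => pq; move: qp; rewrite pq; lia.
have [cR cs1 _] := rot_paramsP (st_mem st 6 0 0) (st_mem st 6 0 1).
rewrite -/cs in cR cs1.
have [[v1 m1] r1 t1 c1 s1] := exec_set_params st.
set st1 := exec set_params st in v1 m1 r1 t1 c1 s1.
pose st2 := exec (Emit rowp rowq cosE sinE) st1.
have iv2 : st_ivar st2 = st_ivar st1 by [].
have m2 : st_mem st2 = st_mem st1 by [].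
have t2 : st_cost st2 = (st_cost st1 + 1)%N by [].
have r2 : st_rots st2 = rcons (st_rots st) (Rotation p q cs.1 cs.2).
  by rewrite -pE /= r1 c1 s1 !v1 // sq.
have iv1 x : x != 4%N -> st_ivar st2 x = st_ivar st x by rewrite iv2; apply: v1.
have := @exec_fill_upper _ st2; cbv zeta; rewrite !iv1 // sq pE => /(_ q0)[].
set st3 := exec _ st2 => v3 r3 t3 m3 u3.
have iv3 x : x != 4%N -> st_ivar st3 x = st_ivar st x by move=> h; rewrite v3 // iv1.
have := @exec_rotate_gen _ st3 1; cbv zeta; rewrite !iv3 // sq pE => /(_ q0 isT)[].
set st4 := exec _ st3 => -[v4 m4] r4 t4 u4.
have iv4 x : x != 4%N -> st_ivar st4 x = st_ivar st x by move=> h; rewrite v4 // iv3.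
have := @exec_rotate_gen _ st4 2; cbv zeta; rewrite !iv4 // sq pE => /(_ q0 isT)[].
set st5 := exec _ st4 => -[v5 m5] r5 t5 u5.
have iv5 x : x != 4%N -> st_ivar st5 x = st_ivar st x by move=> h; rewrite v5 // iv4.
have := @exec_rotate_rows _ st5; cbv zeta; rewrite !iv5 // sq pE => /(_ q0)[].
set st6 := exec _ st5 => -[v6 m6] r6 t6 u6.
have iv6 x : x != 4%N -> st_ivar st6 x = st_ivar st x by move=> h; rewrite v6 // iv5.
have := @exec_rotate_cols _ st6; cbv zeta; rewrite !iv6 // sq pE => /(_ q0)[].
set st7 := exec _ st6 => -[v7 m7] r7 t7 u7.
have e7 : st' = st7 by rewrite /st' /rotate !exec_Seq.
rewrite e7.
have iv7 x : x != 4%N -> st_ivar st7 x = st_ivar st x by move=> h; rewrite v7 // iv6.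
have rots7 : st_rots st7 = rcons (st_rots st) (Rotation p q cs.1 cs.2).
  by rewrite r7 r6 r5 r4 r3 r2.
have c3 i j : st_mem st3 7 i j = st_mem st1 7 i j by rewrite m3.
have c4 i j : st_mem st4 7 i j = st_mem st1 7 i j by rewrite m4.
have c5 i j : st_mem st5 7 i j = st_mem st1 7 i j by rewrite m5.
have c6 i j : st_mem st6 7 i j = st_mem st1 7 i j by rewrite m6.
rewrite c3 c1 c3 s1 rk in u4.
rewrite c4 c1 c4 s1 rk in u5.
rewrite c5 c1 c5 s1 rk in u6.
rewrite c6 c1 c6 s1 rk rn in u7.
pose G := givens n (Rotation p q cs.1 cs.2).
have Q7 : accQ st7 = G *m accQ st by rewrite /accQ rots7 givens_prod_rcons.
have U7 : curU st7 = G *m curU st by rewrite /curU Q7 mulmxA.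
have V7 : curV st7 = G *m curV st by rewrite /curV Q7 mulmxA.
have M7 : curM M st7 = G *m curM M st *m G ^t*.
  by rewrite /curM Q7 trmxC_mul !mulmxA.
split=> //; last first.
  (* The contributions sum to at most [42 * k + 81], which [k > 0] bounds by [123 * k]. *)
  by rewrite rk in t4 t5 t6 t7; rewrite rkk in t3; lia.
split; rewrite ?iv7 //.
- rewrite rots7 all_rcons rok andbT /givens_ok /= !ltn_ord cR cs1 eqxx !andbT.
  by rewrite (inj_eq val_inj).
- move=> i m; rewrite U7 givens_mulE // m7 // m6 // m5 // u4 // -!(inj_eq val_inj).
  by rewrite !m3 // m2 !m1 // !rU.
- move=> i m; rewrite V7 givens_mulE // m7 // m6 // u5 // -!(inj_eq val_inj).
  by rewrite !m4 // !m3 // m2 !m1 // !rV.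
have low5 (i j : 'I_n) : (j <= i)%N || ((i == p) && (j == q)) ->
    st_mem st5 0 i j = curM M st i j.
  rewrite m5 // m4 //; have [/andP[/eqP-> /eqP->] _|npq] := boolP ((i == p) && (j == q)).
    rewrite u3 (upper_entry p q sk rp) m2 rkk !m1 // rM //; last by lia.
    by congr (_ + _); apply: eq_bigr => m _; rewrite !m1.
  by rewrite orbF => ji; rewrite m3 ?m2 ?m1 ?rM.
(* The entry [(p, q)] is tracked as well, since the column update combines it with [(p, p)]. *)
have low6 (i j : 'I_n) : (j <= i)%N || ((i == p) && (j == q)) ->
    st_mem st6 0 i j = (G *m curM M st) i j.
  move=> ij; rewrite givens_mulE // u6 !(inj_eq val_inj).
  have jE : (j == q) = (j == q :> nat) by [].
  have pE' : (p == p) by [].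
  have [ip|ip] := eqVneq i p; last have [iq|iq] := eqVneq i q.
  - rewrite ip eqxx /= jE in ij.
    have [h|h] := boolP (_ <= _ < _)%N.
      by rewrite !low5 ?eqxx ?jE //=; lia.
    by rewrite ip low5 ?eqxx ?jE //= !band ?mulr0 ?addr0 //; lia.
  - rewrite iq [q == p]eq_sym (negPf neq_pq) orbF in ij.
    have [h|h] := boolP (_ <= _ < _)%N.
      by rewrite !low5 ?eqxx ?jE //=; lia.
    by rewrite iq low5 ?ij //= !band ?mulr0 ?subr0 //; lia.
  - by rewrite if_same low5.
have far (i j : 'I_n) : (p + (k + 3) <= i)%N -> (j <= q)%N ->
    (G *m curM M st) i j = 0.
  move=> ij jq; rewrite givens_mulE //.
  have -> : (i == p) = false by apply/eqP => e; move: ij; rewrite e; lia.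
  have -> : (i == q) = false by apply/eqP => e; move: ij; rewrite e; lia.
  by rewrite band //; lia.
move=> i j ij; rewrite M7 mul_givens_trmxCE // u7 !(inj_eq val_inj) ltn_ord andbT.
have [jp|jp] := eqVneq j p; last have [jq|jq] := eqVneq j q.
- rewrite jp in ij *; have [h|h] := boolP (_ <= _ < _)%N.
    rewrite !low6 ?ij // eqxx andbT.
    have [_|ip] := eqVneq i p; rewrite ?orbT // orbF.
    by have : (i != p :> nat) by []; lia.
  by rewrite low6 ?ij // !far ?mulr0 ?addr0 //; lia.
- rewrite jq in ij *; have [h|h] := boolP (_ <= _ < _)%N.
    by rewrite !low6 ?ij //; lia.
  by rewrite low6 ?ij // !far ?mulr0 ?subr0 //; lia.
- by case: ifP; rewrite low6 ?ij.
Qed.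
End Representation.

Definition load_pivots a col :=
  Seq (CSet 6 idx0 idx0 (CGet a rowp col)) (CSet 6 idx0 idx1 (CGet a rowq col)).
Definition annihilate a col := Seq (load_pivots a col) rotate.

(* Row x of a matrix rotated in the plane (q - 1, q) depends on the old row y. *)
Definition mixed (q x y : nat) : Prop :=
  y = x \/ (q <= x.+1 /\ x <= q /\ q <= y.+1 /\ y <= q)%N.

(** * Zero patterns *)

Section Patterns.
Variables (C : numClosedFieldType) (n k : nat) (U0 V0 : 'M[C]_(n, k)).
Implicit Types (st : state C) (M : 'M[C]_n).

Lemma givens_mul_eq0 m (M : 'M[C]_(n, m)) (p q : 'I_n) c s (i : 'I_n) (j : 'I_m) :
    q = p.+1 :> nat -> (forall a : 'I_n, mixed q i a -> M a j = 0) ->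
  (givens n (Rotation p q c s) *m M) i j = 0.
Proof.
move=> qp Z; rewrite givens_mulE; last by apply/eqP => e; move: qp; rewrite e; lia.
have [ip|_] := eqVneq i p; last have [iq|_] := eqVneq i q.
- by rewrite !Z ?mulr0 ?addr0 // ip /mixed; lia.
- by rewrite !Z ?mulr0 ?subr0 // iq /mixed; lia.
- by rewrite Z //; left.
Qed.

Lemma givens_conj_eq0 M (p q : 'I_n) c s (i j : 'I_n) (G := givens n (Rotation p q c s)) :
    q = p.+1 :> nat -> c \is Num.real ->
    (forall a b : 'I_n, mixed q i a -> mixed q j b -> M a b = 0) ->
  (G *m M *m G ^t*) i j = 0.
Proof.
move=> qp cR Z.
have Z' (b : 'I_n) : mixed q j b -> (G *m M) i b = 0.
  by move=> jb; apply: givens_mul_eq0 => // a ia; apply: Z.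
rewrite mul_givens_trmxCE //; last by apply/eqP => e; move: qp; rewrite e; lia.
have [jp|_] := eqVneq j p; last have [jq|_] := eqVneq j q.
- by rewrite !Z' ?mulr0 ?addr0 // jp /mixed; lia.
- by rewrite !Z' ?mulr0 ?subr0 // jq /mixed; lia.
- by rewrite Z' //; left.
Qed.

Lemma rot_params_kill m (M : 'M[C]_(n, m)) (p q : 'I_n) (j : 'I_m)
    (cs := rot_params (M p j) (M q j)) : p != q ->
  (givens n (Rotation p q cs.1 cs.2) *m M) q j = 0.
Proof.
move=> pq; rewrite givens_mulE // eqxx eq_sym (negPf pq).
by have [_ _] := rot_paramsP (M p j) (M q j).
Qed.

Definition vanishM M st (Z : nat -> nat -> Prop) :=
  forall i j : 'I_n, Z i j -> curM M st i j = 0.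
Definition vanishU st (Z : nat -> nat -> Prop) :=
  forall (i : 'I_n) (m : 'I_k), Z i m -> curU U0 st i m = 0.

(** Turns a rotation into bookkeeping on zero patterns: a new zero is either the target entry or fed
    by old zeros only. For [a = 0] the target column lies left of both rotated columns, so the right
    factor cannot refill the target; for [a = 1] there is no right factor. *)
Lemma exec_annihilate M kk st a col (ZM ZU ZM' ZU' : nat -> nat -> Prop) (q : nat)
    (t := ieval (st_ivar st) col) (st' := exec (annihilate a col) st) :
    skew_part U0 V0 M kk -> represents U0 V0 M kk st -> (0 < k)%N ->
    st_ivar st 3 = q -> (0 < q < n)%N ->
    (a = 0 /\ t.+1 < q \/ a = 1 /\ t < k)%N ->
    vanishM M st ZM -> vanishU st ZU ->
    (forall i j, (j + k + 1 < i < n)%N -> ZM i j) ->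
    (forall i j, (i < n)%N -> (j < n)%N -> ZM' i j -> [/\ a = 0, i = q & j = t]%N \/
       forall a b, (a < n)%N -> (b < n)%N -> mixed q i a -> mixed q j b -> ZM a b) ->
    (forall i j, (i < n)%N -> (j < k)%N -> ZU' i j -> [/\ a = 1, i = q & j = t]%N \/
       forall a, (a < n)%N -> mixed q i a -> ZU a j) ->
  [/\ represents U0 V0 M kk st', vanishM M st' ZM', vanishU st' ZU',
      forall x : nat, x != 4%N -> st_ivar st' x = st_ivar st x &
      (st_cost st' <= st_cost st + 200 * k)%N].
Proof.
move=> sk rp k0 sq /andP[q0 qn] ta vM vU band hM hU.
have lp : (q - 1 < n)%N by lia.
pose p' := Ordinal lp; pose q' := Ordinal qn.
have qp : q' = p'.+1 :> nat by rewrite /=; lia.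
have pq : p' != q' by apply/eqP => e; move: qp; rewrite e; lia.
pose st1 := exec (load_pivots a col) st.
have rp1 : represents U0 V0 M kk st1 by case: rp.
have a6 : (a == 6)%N = false by lia.
have x1 : st_mem st1 6 0 0 = st_mem st a p' t by rewrite /= sq.
have y1 : st_mem st1 6 0 1 = st_mem st a q' t by rewrite /= sq a6.
have [||rp' rots' iv' cost'] := exec_rotate sk rp1 k0 qp.
- by rewrite /= sq.
- by move=> i j ij; apply: vM; apply: band; rewrite ltn_ord andbT.
rewrite x1 y1 in rots'.
set cs := rot_params _ _ in rots'.
have [cR _ _] := rot_paramsP (st_mem st a p' t) (st_mem st a q' t).
have e' : exec rotate st1 = st' by rewrite /st' /annihilate exec_Seq.
rewrite e' in rp' rots' iv' cost'.
pose G := givens n (Rotation p' q' cs.1 cs.2).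
have Q' : accQ n st' = G *m accQ n st by rewrite /accQ rots' givens_prod_rcons.
have UE : curU U0 st' = G *m curU U0 st by rewrite /curU Q' mulmxA.
have ME : curM M st' = G *m curM M st *m G ^t*.
  by rewrite /curM Q' trmxC_mul !mulmxA.
split=> //; last by apply: leq_trans cost' _; rewrite /= !addn0.
- move=> i j Zij; rewrite ME.
  have [[a0 iq jt]|Zab] := hM i j (ltn_ord i) (ltn_ord j) Zij; last first.
    apply: givens_conj_eq0 => // a' b' h1 h2.
    by apply: vM; apply: Zab.
  have -> : i = q' by apply: val_inj.
  (* This is where [t.+1 < q] is used: column [t] differs from [q - 1] and [q]. *)
  have jp : (j < p')%N by rewrite /=; lia.
  rewrite mul_givens_trmxCE // ifN; last by apply/eqP => e; move: jp; rewrite e; lia.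
  rewrite ifN; last by apply/eqP => e; move: jp; rewrite e qp; lia.
  rewrite /G /cs -jt a0 !(repr_M rp) //; [|by lia|by lia].
  exact: rot_params_kill.
- move=> i m Zim; rewrite UE.
  have [[a1 iq jt]|Zab] := hU i m (ltn_ord i) (ltn_ord m) Zim; last first.
    by apply: givens_mul_eq0 => // a' h1; apply: vU; apply: Zab.
  have -> : i = q' by apply: val_inj.
  rewrite /G /cs -jt a1 !(repr_U rp).
  exact: rot_params_kill.
Qed.

End Patterns.

(** * The two phases: reduction to banded form, then bulge chasing *)

Definition band_phase_step :=
  Seq (ISet 3 (IAdd (IAdd (IVar 9) idx1) (IVar 6)))
      (IfLe (ISub rowq (IVar 9)) (IVar 1)
         (annihilate 1 (ISub (ISub rowq (IVar 9)) idx1))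
         (annihilate 0 (ISub (ISub rowq idx1) (IVar 1)))).
Definition band_phase_sweep := For 6 (IVar 5) band_phase_step.
Definition band_phase :=
  For 5 (IVar 0) (Seq (ISet 9 (ISub (ISub (IVar 0) idx1) (IVar 5))) band_phase_sweep).

(** Mixing columns [q - 1] and [q] spills the band-edge entry [(q + k, q)] into [(q + k, q - 1)],
    the next bulge. The guard means [q < n]: once the bulge has left the matrix, the remaining
    iterations rotate nothing. *)
Definition hess_phase_chase :=
  Seq (IfLe (IAdd rowq idx1) (IVar 0) (annihilate 0 (IVar 8)) Skip)
      (Seq (ISet 8 (ISub rowq idx1)) (ISet 3 (IAdd rowq (IVar 1)))).
Definition hess_phase_entry :=
  Seq (ISet 3 (IAdd (IVar 5) (ISub (IVar 1) (IVar 6))))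
      (Seq (ISet 8 (IVar 5)) (For 7 (IAdd (IDiv (IVar 0) (IVar 1)) idx1) hess_phase_chase)).
Definition hess_phase_column := For 6 (ISub (IVar 1) idx1) hess_phase_entry.
Definition hess_phase := For 5 (IVar 0) hess_phase_column.

Section Phases.
Variables (C : numClosedFieldType) (n k : nat) (U0 V0 : 'M[C]_(n, k)).
Implicit Types (st : state C) (M : 'M[C]_n).
Hypothesis k0 : (0 < k)%N.

Lemma exec_IfLe e1 e2 p1 p2 st : exec (IfLe e1 e2 p1 p2) st =
  if (ieval (st_ivar st) e1 <= ieval (st_ivar st) e2)%N then exec p1 st else exec p2 st.
Proof. by []. Qed.

Lemma represents_set M kk st x m : (2 < x)%N ->
  represents U0 V0 M kk st -> represents U0 V0 M kk (set_ivar x m st).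
Proof.
move=> x2 [h0 h1 h2 h3 h4 h5 h6]; split=> //=.
all: by rewrite ifN //; lia.
Qed.

(* The state of the sweep for p when q = r is the next rotation. *)
Definition sweepM p r i j :=
  (j < i /\ (j < p \/ j + k + 1 < i \/ (i = j + k + 1 /\ (i < r \/ r <= j + 1))))%N.
Definition sweepU p r i m := (p + m + 1 < i \/ (i = p + m + 1 /\ i < r))%N.

(** In the concatenation of [Q U] with the columns of [S] from [p] on, column [c] of [S] has index
    [k + c - p], so both branches remove the entry of row [r] at index [r - p - 1]. The only fill-in
    on this diagonal is at [(r + k, r - 1)] in [S]; it waits for rotation [r + k]. *)
Lemma exec_band_phase_step M st p r m (st' := exec band_phase_step st) :
    skew_part U0 V0 M 0 ->
    represents U0 V0 M 0 st -> st_ivar st 9 = p -> st_ivar st 6 = m ->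
    r = (p + 1 + m)%N -> (r < n)%N ->
    vanishM M st (sweepM p r) -> vanishU U0 st (sweepU p r) ->
  [/\ represents U0 V0 M 0 st', st_ivar st' 9 = p, vanishM M st' (sweepM p r.+1),
      vanishU U0 st' (sweepU p r.+1) & (st_cost st' <= st_cost st + 200 * k)%N].
Proof.
move=> sk rp s9 s6 rE rn vM vU.
rewrite /st' /band_phase_step exec_Seq exec_IfLe.
set st1 := exec (ISet _ _) st.
have s3 : st_ivar st1 3 = r by rewrite /= s9 s6 rE.
have rp1 : represents U0 V0 M 0 st1 by apply: represents_set.
have s1 : st_ivar st1 1 = k by case: rp1.
have r0n : (0 < r < n)%N by rewrite rn rE; lia.
have s9' : st_ivar st1 9 = p by [].
have vM1 : vanishM M st1 (sweepM p r) by [].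
have vU1 : vanishU U0 st1 (sweepU p r) by [].
have c1 : st_cost st1 = st_cost st by [].
have band i j : (j + k + 1 < i < n)%N -> sweepM p r i j by rewrite /sweepM; lia.
move: st1 s3 rp1 s1 s9' vM1 vU1 c1 => {st'} st1 s3 rp1 s1 s9' vM1 vU1 c1.
have -> : (ieval (st_ivar st1) (ISub rowq (IVar 9)) <= ieval (st_ivar st1) (IVar 1))%N =
  (r - p <= k)%N by rewrite /= s3 s9' s1.
case: ifP => h.
- have [| | |h1 h2 h3 h4 h5] := @exec_annihilate C n k U0 V0 M 0 st1 1
    (ISub (ISub rowq (IVar 9)) idx1) _ _ (sweepM p r.+1) (sweepU p r.+1) r
    sk rp1 k0 s3 r0n _ vM1 vU1 band.
  + by right; rewrite /= s3 s9'; lia.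
  + by move=> i j li lj Z; right => a b la lb; move: Z; rewrite /sweepM /mixed; lia.
  + move=> i j li lj Z; rewrite /= s3 s9'; have [e|e] := boolP ((i == r) && (j == r - p - 1)%N).
      by left; split=> //; lia.
    by right => a la; move: Z; rewrite /sweepU /mixed; lia.
  + by split=> //; [rewrite h4 | rewrite -c1].
- have [| | |h1 h2 h3 h4 h5] := @exec_annihilate C n k U0 V0 M 0 st1 0
    (ISub (ISub rowq idx1) (IVar 1)) _ _ (sweepM p r.+1) (sweepU p r.+1) r
    sk rp1 k0 s3 r0n _ vM1 vU1 band.
  + by left; rewrite /= s3 s1; lia.
  + move=> i j li lj Z; rewrite /= s3 s1; have [e|e] := boolP ((i == r) && (j == r - 1 - k)%N).
      by left; split=> //; lia.
    by right => a b la lb; move: Z; rewrite /sweepM /mixed; lia.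
  + by move=> i j li lj Z; right => a la; move: Z; rewrite /sweepU /mixed; lia.
  + by split=> //; [rewrite h4 | rewrite -c1].
Qed.

Lemma exec_band_phase_sweep M st p (st' := exec band_phase_sweep st) :
    skew_part U0 V0 M 0 -> represents U0 V0 M 0 st -> st_ivar st 9 = p ->
    (p < n)%N -> st_ivar st 5 = (n - 1 - p)%N ->
    vanishM M st (sweepM p p.+1) -> vanishU U0 st (sweepU p p.+1) ->
  [/\ represents U0 V0 M 0 st', vanishM M st' (sweepM p n), vanishU U0 st' (sweepU p n) &
      (st_cost st' <= st_cost st + n * (200 * k))%N].
Proof.
move=> sk rp s9 pn s5 vM vU.
pose I m st' := [/\ represents U0 V0 M 0 st', st_ivar st' 9 = p,
  vanishM M st' (sweepM p (p + 1 + m)), vanishU U0 st' (sweepU p (p + 1 + m)) &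
  (st_cost st' <= st_cost st + m * (200 * k))%N].
have : I (st_ivar st 5) st'.
  apply: (@exec_For _ I) => [|m st1 ltm [h1 h2 h3 h4 h5]].
    by split; rewrite ?addn0 // addn1.
  rewrite /= s5 in ltm.
  have [| |] := 
    @exec_band_phase_step M (set_ivar 6 m st1) p (p + 1 + m) m sk _ h2 erefl erefl _ h3 h4.
  + exact: represents_set.
  + by lia.
  rewrite -addnS => g1 g2 g3 g4 g5; split=> //.
  by apply: leq_trans g5 _; rewrite mulSn /=; lia.
rewrite s5 => -[h1 h2]; have -> : (p + 1 + (n - 1 - p) = n)%N by lia.
by move=> h3 h4 h5; split=> //; apply: leq_trans h5 _; rewrite leq_add2l leq_mul2r; lia.
Qed.

Lemma exec_band_phase M st (st' := exec band_phase st) :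
    skew_part U0 V0 M 0 -> represents U0 V0 M 0 st ->
    vanishM M st (fun i j => j < i)%N ->
  [/\ represents U0 V0 M 0 st', vanishM M st' (fun i j => j + k < i)%N,
      vanishU U0 st' (fun i m => m < i)%N &
      (st_cost st' <= st_cost st + n * (n * (200 * k)))%N].
Proof.
move=> sk rp vM; have rn := repr_n rp.
pose I m st' := [/\ represents U0 V0 M 0 st',
  vanishM M st' (sweepM (n - m) n), vanishU U0 st' (sweepU (n - m) n) &
  (st_cost st' <= st_cost st + m * (n * (200 * k)))%N].
have : I (st_ivar st 0) st'.
  apply: (@exec_For _ I) => [|m st1 ltm [h1 h2 h3 h4]].
    split; rewrite ?addn0 //; first by move=> i j []; move=> ? _; apply: vM.
    by move=> i m; rewrite /sweepU; have := ltn_ord i; lia.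
  rewrite /= rn in ltm; rewrite exec_Seq.
  set st2 := set_ivar 5 m st1; set st3 := exec (ISet _ _) st2.
  have s0 : st_ivar st1 0 = n by case: h1.
  have [||||||] := @exec_band_phase_sweep M st3 (n - m.+1) sk.
  + by apply: (@represents_set _ _ st2 9) => //; apply: represents_set.
  + by rewrite /= s0; lia.
  + by lia.
  + by rewrite /=; lia.
  + move=> i j Z; apply: h2; move: Z (ltn_ord i); rewrite /sweepM; lia.
  + move=> i j Z; apply: h3; move: Z (ltn_ord i); rewrite /sweepU; lia.
  move=> g1 g2 g3 g4; split=> //.
  by apply: leq_trans g4 _; rewrite mulSn /=; lia.
rewrite rn /I subnn => -[h1 h2 h3 h4]; split=> //.
  by move=> i j ij; apply: h2; rewrite /sweepM; have := ltn_ord i; lia.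
by move=> i j ij; apply: h3; rewrite /sweepU; have := ltn_ord i; lia.
Qed.

(* Columns before j are in Hessenberg form, column j has t entries below the
   diagonal left; (r, tc) is the bulge. *)
Definition banded j t i c :=
  ((c < j /\ c + 1 < i) \/ (c = j /\ j + t < i) \/ (j < c /\ c + k < i))%N.
Definition bulge j t r tc i c := (banded j t i c /\ ~ (i = r /\ c = tc)).

(** The bulge is either the entry of column [j] being removed or one created by a previous rotation.
    Since [1 < t], the columns [r - 1] and [r] lie right of [j], so the columns already treated are
    not mixed with later ones. *)
Lemma bulge_step j t r tc a b a' b' : (1 < t <= k)%N ->
    (tc = j /\ r = j + t \/ tc = r - k - 1 /\ j + t + k <= r)%N ->
    bulge j (t - 1) (r + k) (r - 1) a b -> a <> r \/ b <> tc ->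
  mixed r a a' -> mixed r b b' -> bulge j (t - 1) r tc a' b'.
Proof.
move=> tk tcP [Z1 Z2] ne ma mb.
by case: Z1 => [|[]] Z1; case: ma => [->|ma]; case: mb => [->|mb]; case: tcP => tcE;
   split; rewrite /banded; lia.
Qed.

Lemma exec_hess_phase_chase M st j t q r (tc := if q == 0%N then j else (r - k - 1)%N)
    (st' := exec hess_phase_chase st) :
    skew_part U0 V0 M k -> represents U0 V0 M k st ->
    (1 < t <= k)%N -> st_ivar st 3 = r -> st_ivar st 8 = tc ->
    r = (j + t + q * k)%N -> vanishM M st (bulge j (t - 1) r tc) ->
  [/\ represents U0 V0 M k st', st_ivar st' 3 = (r + k)%N, st_ivar st' 8 = (r - 1)%N,
      st_ivar st' 5 = st_ivar st 5 /\ st_ivar st' 6 = st_ivar st 6 &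
      vanishM M st' (bulge j (t - 1) (r + k) (r - 1)) /\
      (st_cost st' <= st_cost st + 200 * k)%N].
Proof.
move=> sk rp tk s3 s8 rE vM.
have rn := repr_n rp; have rk := repr_k rp.
rewrite /st' /hess_phase_chase exec_Seq.
set st1 := exec (IfLe _ _ _ _) st.
have rtc : (q == 0 \/ q <> 0 /\ j + t + k <= r)%N.
  by rewrite rE; case: (q) => [|q']; [left | right; split=> //; rewrite mulSn; lia].
have tcP : (tc = j /\ r = j + t \/ tc = r - k - 1 /\ j + t + k <= r)%N.
  by rewrite /tc rE; case: (q) => [|q'] /=; [left | right; rewrite mulSn]; lia.
suff [h1 h2 h3 h4] : [/\ represents U0 V0 M k st1,
   vanishM M st1 (bulge j (t - 1) (r + k) (r - 1)),
   forall x : nat, x != 4%N -> st_ivar st1 x = st_ivar st x &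
      (st_cost st1 <= st_cost st + 200 * k)%N].
  have e3 := h3 3%N isT; rewrite s3 in e3.
  have e1 := h3 1%N isT; rewrite rk in e1.
  split.
  - rewrite exec_Seq; apply: (@represents_set _ _ _ 3) => //.
    exact: (@represents_set _ _ _ 8).
  - by rewrite /= e3 e1.
  - by rewrite /= e3.
  - by rewrite /= !h3.
  - by split=> //=.
rewrite /st1 exec_IfLe.
have -> : (ieval (st_ivar st) (IAdd rowq idx1) <= ieval (st_ivar st) (IVar 0))%N = (r < n)%N.
  by rewrite /= s3 rn addn1.
case: ifP => h.
  have r0 : (0 < r < n)%N by lia.
  have [| | | | |h1 h2 h3 h4 h5] := @exec_annihilate C n k U0 V0 M k st 0 (IVar 8)
    (bulge j (t - 1) r tc) (fun _ _ => False) (bulge j (t - 1) (r + k) (r - 1))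
    (fun _ _ => False) r sk rp k0 s3 r0 _ vM.
  - by left; rewrite /= s8; lia.
  - by move=> a b [].
  - by move=> a b; rewrite /bulge /banded; lia.
  - move=> a b la lb Z; rewrite /= s8; have [e|e] := boolP ((a == r) && (b == tc)%N).
      by left; split=> //; lia.
    by right => a' b' _ _; apply: bulge_step Z _ => //; lia.
  - by move=> a b _ _ [].
  - by split.
(* Here [r >= n]: the excepted position is outside the matrix, and nothing is executed. *)
split; rewrite ?leq_addr // => a b [Z _]; apply: vM; split=> //.
by have := ltn_ord a; lia.
Qed.

Lemma exec_hess_phase_entry M st j t (st' := exec hess_phase_entry st) :
    skew_part U0 V0 M k -> represents U0 V0 M k st -> (1 < t <= k)%N ->
    st_ivar st 5 = j -> st_ivar st 6 = (k - t)%N -> vanishM M st (banded j t) ->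
  [/\ represents U0 V0 M k st', st_ivar st' 5 = j, vanishM M st' (banded j (t - 1)) &
      (st_cost st' <= st_cost st + (n %/ k + 1) * (200 * k))%N].
Proof.
move=> sk rp tk s5 s6 vM.
have rn := repr_n rp; have rk := repr_k rp.
rewrite /st' /hess_phase_entry !exec_Seq.
set st1 := exec (ISet 3 _) st; set st2 := exec (ISet 8 _) st1.
have rp1 : represents U0 V0 M k st1 by apply: (@represents_set _ _ st 3).
have rp2 : represents U0 V0 M k st2 by apply: (@represents_set _ _ st1 8).
pose I q st' := [/\ represents U0 V0 M k st', st_ivar st' 5 = j,
  st_ivar st' 3 = (j + t + q * k)%N /\
  st_ivar st' 8 = (if q == 0%N then j else j + t + q * k - k - 1)%N,
  vanishM M st' (bulge j (t - 1) (st_ivar st' 3) (st_ivar st' 8)) &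
  (st_cost st' <= st_cost st + q * (200 * k))%N].
have : I (ieval (st_ivar st2) (IAdd (IDiv (IVar 0) (IVar 1)) idx1))
  (exec (For 7 (IAdd (IDiv (IVar 0) (IVar 1)) idx1) hess_phase_chase) st2).
  apply: (@exec_For _ I) => [|q st3 ltq [h1 h2 [h3 h3'] h4 h5]].
    split; rewrite ?addn0 //.
      by split=> //=; rewrite rk s5 s6; lia.
    (* Initially the entry to be removed, [(j + t, j)], is itself the exception to the target
       pattern. *)
    move=> a b [Z1 Z2]; apply: vM; move: Z1 Z2 => /=.
    by rewrite rk s5 s6 /banded; lia.
  rewrite h3 h3' in h4.
  have [||g1 g2 g3 [g4 _] [g5 g6]] :=
    @exec_hess_phase_chase M (set_ivar 7 q st3) j t q _ sk _ tk h3 h3' erefl.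
  + exact: represents_set.
  + exact: h4.
  split=> //.
  + by rewrite g4.
  + by rewrite g2 g3; split; rewrite /= mulSn; lia.
  + by rewrite g2 g3.
  + by apply: leq_trans g6 _; rewrite mulSn /=; lia.
have -> : ieval (st_ivar st2) (IAdd (IDiv (IVar 0) (IVar 1)) idx1) = (n %/ k + 1)%N.
  by rewrite /= rn rk.
case=> h1 h2 [h3 h3'] h4 h5; split=> //.
move=> a b Z; apply: h4; split=> //; rewrite h3 => -[ar _].
(* As [(n %/ k + 1) * k > n], the last excepted row is below the matrix, so no exception remains. *)
have := ltn_ord a; rewrite ar mulnDl mul1n.
by have := divn_eq n k; have := ltn_pmod n k0; lia.
Qed.

Lemma exec_hess_phase M st (st' := exec hess_phase st) :
    skew_part U0 V0 M k -> represents U0 V0 M k st ->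
    vanishM M st (fun i j => j + k < i)%N ->
  [/\ represents U0 V0 M k st', vanishM M st' (fun i j => j + 1 < i)%N &
      (st_cost st' <= st_cost st + n * ((k - 1) * ((n %/ k + 1) * (200 * k))))%N].
Proof.
move=> sk rp vM; have rn := repr_n rp.
pose w := ((n %/ k + 1) * (200 * k))%N.
pose I j st' := [/\ represents U0 V0 M k st', vanishM M st' (banded j k) &
  (st_cost st' <= st_cost st + j * ((k - 1) * w))%N].
have : I (st_ivar st 0) st'.
  apply: (@exec_For _ I) => [|j st1 _ [h1 h2 h3]].
    by split; rewrite ?addn0 // => a b Z; apply: vM; move: Z; rewrite /banded; lia.
  set st2 := set_ivar 5 j st1.
  have rp2 : represents U0 V0 M k st2 by apply: represents_set.
  pose J m st' := [/\ represents U0 V0 M k st', st_ivar st' 5 = j,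
    vanishM M st' (banded j (k - m)) & (st_cost st' <= st_cost st2 + m * w)%N].
  have : J (ieval (st_ivar st2) (ISub (IVar 1) idx1)) (exec hess_phase_column st2).
    apply: (@exec_For _ J) => [|m st3 ltm [g1 g2 g3 g4]].
      by split; rewrite ?addn0 ?subn0.
    rewrite /= (repr_k h1) in ltm.
    have [| | |f1 f2 f3 f4] :=
      @exec_hess_phase_entry M (set_ivar 6 m st3) j (k - m) sk _ _ g2 _ g3.
    + exact: represents_set.
    + by lia.
    + by rewrite /=; lia.
    split=> //.
      by move=> a b Z; apply: f3; move: Z; rewrite -subnDA addn1.
    by apply: leq_trans f4 _; rewrite -/w mulSn [(w + _)%N]addnC addnA leq_add2r.
  have -> : ieval (st_ivar st2) (ISub (IVar 1) idx1) = (k - 1)%N.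
    by rewrite /= (repr_k h1).
  case=> g1 g2 g3 g4; split=> //.
    (* After [k - 1] removals [t] is 1, and the positions of [banded j.+1 k] are among those of
       [banded j 1]. *)
    move=> a b Z; apply: g3; move: Z; rewrite subKn // /banded; lia.
  apply: leq_trans g4 _.
  by rewrite mulSn [((k - 1) * w + _)%N]addnC addnA leq_add2r.
rewrite rn => -[h1 h2 h3]; split=> //.
move=> a b Z; apply: h2; left; have := ltn_ord b; lia.
Qed.
End Phases.

(** * Entrywise loops: adding the low-rank term and writing the output *)

Definition for_cells u1 u2 body := For 5 (IVar u1) (For 6 (IVar u2) body).

Definition add_term :=
  CSet 0 (IVar 5) (IVar 6) (CAdd (CGet 0 (IVar 5) (IVar 6))
    (CMul (CGet 1 (IVar 5) (IVar 7)) (CConj (CGet 2 (IVar 6) (IVar 7))))).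
Definition add_low_rank := for_cells 0 0 (For 7 (IVar 1) add_term).

Definition copy_tril :=
  for_cells 0 0 (IfLe (IVar 6) (IVar 5)
    (CSet 3 (IVar 5) (IVar 6) (CGet 0 (IVar 5) (IVar 6)))
    (CSet 3 (IVar 5) (IVar 6) CZero)).
Definition copy_gen a b :=
  for_cells 0 1 (CSet b (IVar 5) (IVar 6) (CGet a (IVar 5) (IVar 6))).

Definition reduction :=
  Seq band_phase (Seq add_low_rank (Seq (ISet 2 (IVar 1)) hess_phase)).
Definition output := Seq copy_tril (Seq (copy_gen 1 4) (copy_gen 2 5)).
(** For [k = 0] the cost bound is 0, so no counted operation may be executed; then [A = D] is
    already diagonal, and copying is free. *)
Definition hessenberg := Seq (IfLe (IVar 1) idx0 Skip reduction) output.

Section Cells.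
Variable C : numClosedFieldType.
Implicit Types st : state C.

Definition loop_reg (x : nat) := x \in [:: 5; 6; 7]%N.

(** Each cell is written once, from data that the loop has not yet changed. The inner bound is
    evaluated anew in every outer iteration, so [u2] must not be a loop register. *)
Lemma exec_for_cells st u1 u2 body a w (F : nat -> nat -> C)
    (N1 := st_ivar st u1) (N2 := st_ivar st u2) (st' := exec (for_cells u1 u2 body) st) :
    ~~ loop_reg u2 ->
    (forall st1 i j (st2 := exec body st1), (i < N1)%N -> (j < N2)%N ->
       (forall x, ~~ loop_reg x -> st_ivar st1 x = st_ivar st x) ->
       st_ivar st1 5 = i -> st_ivar st1 6 = j ->
       (forall a' i' j', ~~ (a' == a) -> st_mem st1 a' i' j' = st_mem st a' i' j') ->
       st_mem st1 a i j = st_mem st a i j ->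
     [/\ forall x : nat, x != 7%N -> st_ivar st2 x = st_ivar st1 x, st_rots st2 = st_rots st1,
         (st_cost st2 <= st_cost st1 + w)%N, st_mem st2 a i j = F i j &
         forall a' i' j', ~~ [&& a' == a, i' == i & j' == j] ->
           st_mem st2 a' i' j' = st_mem st1 a' i' j']) ->
  [/\ forall x, ~~ loop_reg x -> st_ivar st' x = st_ivar st x, st_rots st' = st_rots st,
      (st_cost st' <= st_cost st + N1 * (N2 * w))%N &
      forall a' i j, st_mem st' a' i j =
        if [&& a' == a, i < N1 & j < N2]%N then F i j else st_mem st a' i j].
Proof.
move=> u2n hbody.
(* [b] is the set of cells already written and [t] the cost so far. *)
pose K b t st' := [/\ forall x, ~~ loop_reg x -> st_ivar st' x = st_ivar st x,
  st_rots st' = st_rots st, (st_cost st' <= st_cost st + t)%N &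
  forall a' i j, st_mem st' a' i j =
    if (a' == a) && b i j then F i j else st_mem st a' i j].
have Kext b b' t t' st1 : b =2 b' -> t = t' -> K b t st1 -> K b' t' st1.
  by move=> bb <- [h1 h2 h3 h4]; split=> // a' i j; rewrite -bb.
pose I m := K (fun i j => (i < m) && (j < N2))%N (m * (N2 * w))%N.
suff: I N1 st' by [].
apply: (@exec_For _ I) => [|m st1 ltm hI].
  by split; rewrite ?addn0 // => a' i j; rewrite andbF.
pose J l := K (fun i j => (i < m) && (j < N2) || (i == m) && (j < l))%N
  (m * (N2 * w) + l * w)%N.
pose J' l st' := J l st' /\ st_ivar st' 5 = m.
set st2 := set_ivar 5 m st1.
have iv2 x : ~~ loop_reg x -> st_ivar st2 x = st_ivar st x.
  move=> nx; case: hI => <- // _ _ _; rewrite /= ifN //.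
  by apply: contra nx => /eqP ->.
have : J' (st_ivar st2 u2) (exec (For 6 (IVar u2) body) st2).
  apply: (@exec_For _ J') => [|l st3 ltl [[h1 h2 h3 h4] h5]].
    split; last by [].
    case: hI => g1 g2 g3 g4; split=> //; first by rewrite addn0.
    by move=> a' i j; rewrite [st_mem _ _ _ _]g4 ltn0 andbF orbF.
  rewrite [ieval _ _]iv2 // in ltl.
  have [|||||g1 g2 g3 g4 g5] := hbody (set_ivar 6 l st3) m l ltm ltl.
  + move=> x nx; rewrite /= ifN ?h1 //; by apply: contra nx => /eqP ->.
  + by [].
  + by [].
  + by move=> a' i' j' na; rewrite /= h4 (negPf na).
  + by rewrite /= h4 !ltnn !andbF.
  split; last by rewrite g1.
  split.
  + move=> x nx; rewrite g1 /= ?ifN ?h1 //; by apply: contra nx => /eqP ->.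
  + by rewrite g2.
  + by apply: leq_trans g3 _; rewrite mulSn /=; lia.
  move=> a' i' j'.
  have [/and3P[/eqP-> /eqP-> /eqP->]|ne] := boolP [&& a' == a, i' == m & j' == l].
    by rewrite g4 !eqxx ltnSn orbT.
  rewrite g5 // [LHS]h4; congr (if _ then _ else _).
  by move: ne; have [_ /=|//] := eqVneq a' a; lia.
rewrite iv2 // => -[hJ _]; move: hJ; apply: Kext.
  by move=> i j; lia.
by rewrite -mulSnr.
Qed.

Lemma exec_copy_gen st a b (st' := exec (copy_gen a b) st) : b != a ->
  [/\ forall x, ~~ loop_reg x -> st_ivar st' x = st_ivar st x, st_rots st' = st_rots st,
      (st_cost st' <= st_cost st)%N &
      forall a' i j, st_mem st' a' i j =
        if [&& a' == b, i < st_ivar st 0 & j < st_ivar st 1]%N then st_mem st a i j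
        else st_mem st a' i j].
Proof.
move=> ba; have [//||h1 h2 h3 h4] := @exec_for_cells st 0 1
  (CSet b (IVar 5) (IVar 6) (CGet a (IVar 5) (IVar 6))) b 0 (st_mem st a).
  move=> st1 i j st2 _ _ _ s5 s6 hm _; split=> //.
  - by rewrite /= s5 s6 !eqxx /= hm // eq_sym.
  - by move=> a' i' j' ne; rewrite /= s5 s6 (negPf ne).
by split=> //; move: h3; rewrite !muln0 addn0.
Qed.

Lemma exec_copy_tril st (st' := exec copy_tril st) :
  [/\ forall x, ~~ loop_reg x -> st_ivar st' x = st_ivar st x, st_rots st' = st_rots st,
      (st_cost st' <= st_cost st)%N &
      forall a' i j, st_mem st' a' i j =
        if [&& a' == 3, i < st_ivar st 0 & j < st_ivar st 0]%N then
          (if (j <= i)%N then st_mem st 0 i j else 0)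
        else st_mem st a' i j].
Proof.
have [//||h1 h2 h3 h4] := @exec_for_cells st 0 0
  (IfLe (IVar 6) (IVar 5) (CSet 3 (IVar 5) (IVar 6) (CGet 0 (IVar 5) (IVar 6)))
    (CSet 3 (IVar 5) (IVar 6) CZero)) 3 0
  (fun i j => if (j <= i)%N then st_mem st 0 i j else 0).
  move=> st1 i j st2 _ _ _ s5 s6 hm _; rewrite /st2 exec_IfLe /= s5 s6.
  by case: ifP => ji; split=> //=; rewrite ?addn0 ?s5 ?s6 ?eqxx //= ?hm //;
    move=> a' i' j' /negPf ->.
by split=> //; move: h3; rewrite !muln0 addn0.
Qed.

Lemma exec_add_low_rank st (st' := exec add_low_rank st) :
  [/\ forall x, ~~ loop_reg x -> st_ivar st' x = st_ivar st x, st_rots st' = st_rots st,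
      (st_cost st' <= st_cost st + st_ivar st 0 * (st_ivar st 0 * (st_ivar st 1 * 3)))%N &
      forall a' i j, st_mem st' a' i j =
        if [&& a' == 0, i < st_ivar st 0 & j < st_ivar st 0]%N then
          st_mem st 0 i j + \sum_(0 <= m < st_ivar st 1) st_mem st 1 i m * (st_mem st 2 j m)^*
        else st_mem st a' i j].
Proof.
apply: (@exec_for_cells st 0 0) => // st1 i j st2 _ _ iv s5 s6 hm m0.
pose I m st' := [/\ forall x : nat, x != 7%N -> st_ivar st' x = st_ivar st1 x,
         st_rots st' = st_rots st1, (st_cost st' <= st_cost st1 + m * 3)%N,
         st_mem st' 0 i j = st_mem st 0 i j +
           \sum_(0 <= m < m) st_mem st 1 i m * (st_mem st 2 j m)^* &
         forall a' i' j', ~~ [&& a' == 0%N, i' == i & j' == j] ->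
           st_mem st' a' i' j' = st_mem st1 a' i' j'].
rewrite -(iv 1%N) //; apply: (@exec_For _ I) => [|m st3 _ [h1 h2 h3 h4 h5]].
  by split; rewrite ?addn0 // m0 big_geq ?addr0.
split=> /=.
- by move=> x x7; rewrite ifN ?h1.
- by [].
- by rewrite mulSn; lia.
- by rewrite !h1 // s5 s6 !eqxx /= h4 big_nat_recr //= addrA !h5 ?hm.
- by move=> a' i' j' ne; rewrite !h1 // s5 s6 (negPf ne) h5.
Qed.
End Cells.

(** * Correctness of the whole program and its total cost *)

Section Correctness.
Variables (C : numClosedFieldType) (n k : nat) (D : 'M[C]_n) (U V : 'M[C]_(n, k)).
Implicit Types (st : state C) (M : 'M[C]_n).

Lemma givens_prod_unitary (gs : seq (rotation C)) :
  all (givens_ok n) gs -> givens_prod n gs \is unitarymx.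
Proof.
elim/last_ind: gs => [_|gs g IH].
  by apply/unitarymxP; rewrite trmx1 map_mx1 mulmx1.
rewrite all_rcons givens_prod_rcons => /andP[ok /IH Qu]; apply: mul_unitarymx => //.
case: g ok => i j c s /and5P[/= ltin ltjn ij cR /eqP cs1].
by apply: (@givens_unitary C n (Ordinal ltin) (Ordinal ltjn)).
Qed.

Lemma loadE m p (M : 'M[C]_(m, p)) (i : 'I_m) (j : 'I_p) : load M i j = M i j.
Proof. by rewrite /load !valK. Qed.

Hypotheses (D_diag : is_diag_mx D) (D_herm : D ^t* = D).
Let A := D + U *m V ^t*.
Let st0 := init D U V.

Lemma skew_D : skew_part U V D 0.
Proof. by left; rewrite D_herm subrr. Qed.

Lemma skewA : A - A ^t* = U *m V ^t* - V *m U ^t*.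
Proof. by rewrite trmxC_add D_herm trmxC_mul trmxCK opprD addrACA subrr add0r. Qed.

Lemma accQ_init : accQ n st0 = 1%:M. Proof. by []. Qed.

Lemma curM_init M : curM M st0 = M.
Proof. by rewrite /curM accQ_init mul1mx (trmx1, map_mx1) map_mx1 mulmx1. Qed.

Lemma represents_init : represents U V D 0 st0.
Proof.
split=> // [i m|i m|i j _].
- by rewrite /curU accQ_init mul1mx /= loadE.
- by rewrite /curV accQ_init mul1mx /= loadE.
- by rewrite curM_init /= loadE.
Qed.

Lemma vanish_init : vanishM D st0 (fun i j => j < i)%N.
Proof.
move=> i j ji; rewrite curM_init; have /is_diag_mxP := D_diag; apply.
by apply: contraTneq ji => ->; rewrite ltnn.
Qed.

(** No rotation is involved: with the same [Q], [Q A Q^H] is [Q D Q^H + (Q U)(Q V)^H]. From here on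
    register 2 holds [k], since the matrix is no longer assumed Hermitian. *)
Lemma represents_add st (st1 := exec add_low_rank st)
    (st2 := exec (ISet 2 (IVar 1)) st1) :
    represents U V D 0 st -> vanishM D st (fun i j => j + k < i)%N ->
    vanishU U st (fun i m => m < i)%N ->
  [/\ represents U V A k st2, vanishM A st2 (fun i j => j + k < i)%N &
      (st_cost st2 <= st_cost st + n * (n * (k * 3)))%N].
Proof.
move=> rp vM vU; have [rn rk _ rok rU rV rM] := rp.
have [h1 h2 h3 h4] := exec_add_low_rank st; rewrite rn rk in h3 h4.
have Q2 : accQ n st2 = accQ n st by rewrite /accQ -[st_rots st2]/(st_rots st1) h2.
have M2 : curM A st2 = curM D st + curU U st *m (curV V st) ^t*.
  by rewrite /curM /curU /curV Q2 mulmxDr mulmxDl trmxC_mul !mulmxA.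
split=> //; last first.
  (* A row [i > j + k] has [i > m] for all [m < k], so this row of [Q U] is zero. *)
  move=> i j ij; rewrite M2 mxE vM // add0r mxE big1 // => m _.
  by rewrite vU ?mul0r //; have := ltn_ord m; lia.
split=> //=; rewrite ?h1 //.
- by rewrite h2.
- by move=> i m; rewrite h4 /= rU /curU Q2.
- by move=> i m; rewrite h4 /= rV /curV Q2.
- move=> i j ij; rewrite h4 !ltn_ord /= M2 mxE rM //; congr (_ + _).
  by rewrite mxE big_mkord; apply: eq_bigr => m _; rewrite rU rV !mxE.
Qed.

Lemma exec_reduction (st := exec reduction st0) : (0 < k <= n)%N ->
  [/\ represents U V A k st, vanishM A st (fun i j => j + 1 < i)%N &
      (st_cost st <= 1000 * (n ^ 2 * k))%N].
Proof.
move=> /andP[k0 kn]; rewrite /st /reduction !exec_Seq.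
have [r1 v1 u1 c1] := exec_band_phase k0 skew_D represents_init vanish_init.
have [r2 v2 c2] := represents_add r1 v1 u1.
have skA : skew_part U V A k by right; rewrite skewA.
have [r3 v3 c3] := exec_hess_phase k0 skA r2 v2.
split=> //; apply: leq_trans c3 _.
(* From [k <= n], [(n %/ k + 1) * k <= 2 * n]. The three stages then cost at most 200, 3 and 400
   times [n ^ 2 * k], and 1000 is a round bound for the sum. *)
have h : ((n %/ k + 1) * (200 * k) <= 400 * n)%N by have := leq_divM n k; lia.
have h' : ((k - 1) * ((n %/ k + 1) * (200 * k)) <= k * (400 * n))%N.
  by apply: leq_mul => //; lia.
have {h'} : (n * ((k - 1) * ((n %/ k + 1) * (200 * k))) <= n * (k * (400 * n)))%N.
  by rewrite leq_mul2l h' orbT.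
have c0 : st_cost st0 = 0%N by [].
rewrite c0 in c1; rewrite expnS expn1; move: c1 c2.
have -> : (n * (n * (200 * k)) = 200 * (n * n * k))%N by ring.
have -> : (n * (n * (k * 3)) = 3 * (n * n * k))%N by ring.
have -> : (n * (k * (400 * n)) = 400 * (n * n * k))%N by ring.
lia.
Qed.

Lemma exec_output M kk st (st' := exec output st) : represents U V M kk st ->
  [/\ st_rots st' = st_rots st, (st_cost st' <= st_cost st)%N,
      out_tril st' n = tril (curM M st), out_U st' n k = curU U st &
      out_V st' n k = curV V st].
Proof.
move=> [rn rk _ _ rU rV rM]; rewrite /st' /output !exec_Seq.
have [i1 r1 c1 m1] := exec_copy_tril st; set st1 := exec copy_tril st in i1 r1 c1 m1 *.
have [//|i2 r2 c2 m2] := @exec_copy_gen _ st1 1 4; set st2 := exec _ st1 in i2 r2 c2 m2 *.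
have [//|i3 r3 c3 m3] := @exec_copy_gen _ st2 2 5; set st3 := exec _ st2 in i3 r3 c3 m3 *.
rewrite rn in m1; rewrite !i1 // rn rk in m2; rewrite !i2 // !i1 // rn rk in m3.
split.
- by rewrite r3 r2 r1.
- by lia.
- apply/matrixP=> i j; rewrite mxE m3 [LHS]/= m2 [LHS]/= m1 !ltn_ord [LHS]/= mxE.
  by case: ifP => // ij; rewrite rM.
- by apply/matrixP=> i j; rewrite mxE m3 [LHS]/= m2 !ltn_ord [LHS]/= m1 [LHS]/= rU.
- by apply/matrixP=> i j; rewrite mxE m3 !ltn_ord [LHS]/= m2 [LHS]/= m1 [LHS]/= rV.
Qed.

Lemma hessenberg_correct (st := exec hessenberg st0) (Q := givens_prod n (st_rots st))
    (H := Q *m A *m Q ^t*) (Ut := out_U st n k) (Vt := out_V st n k) : (k <= n)%N ->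
  [/\ all (givens_ok n) (st_rots st) /\ Q \is unitarymx,
      upper_hessenberg H,
      out_tril st n = tril H,
      H - H ^t* = Ut *m Vt ^t* - Vt *m Ut ^t*
    & (st_cost st <= 1000 * (n ^ 2 * k))%N].
Proof.
move=> kn.
(* Leaving [kk] existential merges the cases [k = 0] and [k > 0]; the output stage is the same for
   both. *)
have [kk [rp vH cost]] : exists kk, let st1 := exec (IfLe (IVar 1) idx0 Skip reduction) st0 in
    [/\ represents U V A kk st1, vanishM A st1 (fun i j => j + 1 < i)%N &
      (st_cost st1 <= 1000 * (n ^ 2 * k))%N].
  rewrite exec_IfLe [ieval _ (IVar 1)]/= [ieval _ idx0]/= leqn0.
  have [k0|k0] := eqVneq k 0%N; last first.
    by exists k; apply: exec_reduction; rewrite lt0n k0.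
  have AD : A = D.
    by rewrite /A [_ *m _](_ : _ = 0) ?addr0 //; apply/matrixP=> i j;
       rewrite !mxE big1 // => m; have := ltn_ord m; rewrite {2}k0.
  exists 0%N; rewrite AD; split=> //; first exact: represents_init.
  by move=> i j ij; apply: vanish_init; lia.
rewrite /H /Ut /Vt /Q /st /hessenberg exec_Seq.
set st1 := exec (IfLe _ _ _ _) st0 in rp vH cost *.
have [-> c2 -> -> ->] := exec_output rp.
split.
- by split; [|apply: givens_prod_unitary]; apply: repr_ok rp.
- by move=> i j ij; apply: vH; rewrite addn1.
- by [].
- have -> : (curM A st1) ^t* = accQ n st1 *m A ^t* *m (accQ n st1) ^t*.
    by rewrite /curM !trmxC_mul trmxCK mulmxA.
  rewrite -/(accQ n st1) -mulmxBl -mulmxBr skewA mulmxBr mulmxBl.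
  by rewrite /curU /curV !trmxC_mul !mulmxA.
- exact: leq_trans c2 cost.
Qed.
End Correctness.

Local Open Scope complex_scope.
Local Open Scope sesquilinear_scope.

Theorem mainTheorem1 :
  exists (P : cmd) (c : nat),
    forall (R : realType) (n k : nat) (D : 'M[R]_n) (U V : 'M[R[i]]_(n, k)),
      (k <= n)%N -> is_diag_mx D ->
      let DC : 'M[R[i]]_n := map_mx (real_complex R) D in
      let A := DC + U *m V ^t* in
      let st := exec P (init DC U V) in
      let Q := givens_prod n (st_rots st) in
      let H := Q *m A *m Q ^t* in
      let Ut := out_U st n k in
      let Vt := out_V st n k in
      [/\ all (givens_ok n) (st_rots st) /\ Q \is unitarymx,
          upper_hessenberg H,
          out_tril st n = tril H,
          H - H ^t* = Ut *m Vt ^t* - Vt *m Ut ^t*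
        & (st_cost st <= c * (n ^ 2 * k))%N].
Proof.
exists hessenberg, 1000%N => R n k D U V kn Ddiag DC.
have DCdiag : is_diag_mx DC.
  by apply/is_diag_mxP=> i j ij; rewrite mxE (is_diag_mxP Ddiag).
apply: hessenberg_correct => //.
apply/matrixP=> i j; rewrite !mxE; have [->|ij] := eqVneq i j.
  by apply/CrealP; rewrite complex_real.
by rewrite !(is_diag_mxP Ddiag) ?rmorph0 // eq_sym.
Qed.
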